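(* Let $\nu>0$ and let $b>0$ with $b\neq 1$. Then there exist no functions $F,G,\Omega$ on $[0,1)$, no scalar pressure field $p$ and no constant $C_\omega\neq 0$ such that the velocity field $\mathbf v=(v_R,v_\alpha,v_\theta)$ given by $$v_R=\frac{G(x)}{r^b},\qquad v_\alpha=\frac{F(x)}{r^b},\qquad v_\theta=\frac{\Omega(x)}{r^b},\qquad x=\cos\alpha,\quad r=R\sin\alpha,$$ together with $p$, is a classical solution of the steady incompressible Navier--Stokes equations $$(\mathbf v\cdot\nabla)\mathbf v=-\nabla p+\nu\,\Delta\mathbf v,\qquad \nabla\cdot\mathbf v=0$$ in the open upper half-space without the vertical axis, $\{R>0,\ 0<\alpha<\pi/2\}$, satisfying the ground conditions (no source/sink, no slip) $$F(0)=G(0)=\Omega(0)=0$$ and the axis conditions $$\lim_{x\to1^-}\Omega(x)=C_\omega\neq0,\qquad\text{and, if } b\neq 2,\quad \lim_{x\to1^-}F(x)(1-x^2)^{(1-b)/2}=0.$$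
   Context: Spherical coordinates $(R,\alpha,\theta)$ on $\mathbb R^3$: $R$ is the distance to the origin, $\alpha$ is the angle between the radius vector and the positive $z$-axis, and $\theta$ is the meridian angle about the $z$-axis. Thus $\alpha=0$ is the positive $z$-axis (vortex axis) and $\alpha=\pi/2$ is the ground plane $z=0$. The components $v_R,v_\alpha,v_\theta$ of $\mathbf v$ are taken with respect to the orthonormal spherical frame $(\mathbf e_R,\mathbf e_\alpha,\mathbf e_\theta)$, and $r=R\sin\alpha$ is the distance to the $z$-axis. The constant $\nu>0$ is the kinematic viscosity and $p=p(R,\alpha,\theta)$ is the scaled (by density) pressure, a single-valued $C^1$ function, hence $2\pi$-periodic in $\theta$. ''Classical'' means that $F,G,\Omega$ are continuous on $[0,1)$ and that all derivatives occurring in the equations after elimination of the pressure exist and are continuous on $(0,1)$ ($F\in C^4(0,1)$, $G\in C^3(0,1)$, $\Omega\in C^2(0,1)$), and the equations hold pointwise. *)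

(* Defs.v *)
From Stdlib Require Import Reals.
From Coquelicot Require Import Coquelicot.
Open Scope R_scope.

(** Vector calculus on R^3, in Cartesian coordinates. *)

Inductive axis : Set := ax_x | ax_y | ax_z.

Definition point : Type := (R * R * R)%type.

Definition scalar_field : Type := point -> R.

(** [v i q] is the [i]-th Cartesian component of [v] at [q]. *)
Definition vector_field : Type := axis -> point -> R.

Definition sum_axes (f : axis -> R) : R := f ax_x + f ax_y + f ax_z.

Definition partial (i : axis) (f : scalar_field) (q : point) : R :=
  let '(x, y, z) := q in
  match i with
  | ax_x => Derive (fun t => f (t, y, z)) x
  | ax_y => Derive (fun t => f (x, t, z)) y
  | ax_z => Derive (fun t => f (x, y, t)) z
  end.

Definition ex_partial (i : axis) (f : scalar_field) (q : point) : Prop :=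
  let '(x, y, z) := q in
  match i with
  | ax_x => ex_derive (fun t => f (t, y, z)) x
  | ax_y => ex_derive (fun t => f (x, t, z)) y
  | ax_z => ex_derive (fun t => f (x, y, t)) z
  end.

(** Meant for open [D]. *)
Definition C1_on (D : point -> Prop) (f : scalar_field) : Prop :=
  forall (i : axis) (q : point), D q ->
    ex_partial i f q /\ continuous (partial i f) q.

Definition laplacian (f : scalar_field) (q : point) : R :=
  sum_axes (fun j => partial j (partial j f) q).

Definition divergence (v : vector_field) (q : point) : R :=
  sum_axes (fun j => partial j (v j) q).

(** [(v . nabla) f] *)
Definition convective (v : vector_field) (f : scalar_field) (q : point) : R :=
  sum_axes (fun j => v j q * partial j f q).

(** [Derive] is total, so this is meaningful only together with the
    differentiability of [v] and [p]. *)
Definition steady_navier_stokes_on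
    (D : point -> Prop) (nu : R) (v : vector_field) (p : scalar_field) : Prop :=
  forall q : point, D q ->
    (forall i : axis,
       convective v (v i) q = - partial i p q + nu * laplacian (v i) q)
    /\ divergence v q = 0.

(** Spherical coordinates: [rho] is the distance to the origin, [alpha] the
    angle with the positive z-axis, [theta] the meridian angle. *)

Definition spherical (rho alpha theta : R) : point :=
  (rho * sin alpha * cos theta, rho * sin alpha * sin theta, rho * cos alpha).

Definition e_R (alpha theta : R) (i : axis) : R :=
  match i with
  | ax_x => sin alpha * cos theta
  | ax_y => sin alpha * sin theta
  | ax_z => cos alpha
  end.

Definition e_alpha (alpha theta : R) (i : axis) : R :=
  match i with
  | ax_x => cos alpha * cos theta
  | ax_y => cos alpha * sin theta
  | ax_z => - sin alpha
  end.

Definition e_theta (theta : R) (i : axis) : R :=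
  match i with
  | ax_x => - sin theta
  | ax_y => cos theta
  | ax_z => 0
  end.

(** The open upper half-space without the vertical axis. *)
Definition half_space_off_axis (q : point) : Prop :=
  exists rho alpha theta : R,
    0 < rho /\ 0 < alpha < PI / 2 /\ q = spherical rho alpha theta.

(** [v] is prescribed on [half_space_off_axis] only; that set is open, so this
    determines all derivatives of [v] there. *)
Definition has_conical_form
    (b : R) (F G Omega : R -> R) (v : vector_field) : Prop :=
  forall rho alpha theta : R, 0 < rho -> 0 < alpha < PI / 2 ->
    let x := cos alpha in
    let r := rho * sin alpha in
    let v_R := G x / Rpower r b in
    let v_alpha := F x / Rpower r b in
    let v_theta := Omega x / Rpower r b in
    forall i : axis,
      v i (spherical rho alpha theta) =
        v_R * e_R alpha theta i
        + v_alpha * e_alpha alpha theta i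
        + v_theta * e_theta theta i.

(** Relative continuity on [0,1): one-sided at 0, and insensitive to the values
    of [f] outside the interval. *)
Definition continuous_on_01 (f : R -> R) : Prop :=
  forall x : R, 0 <= x < 1 ->
    filterlim f (within (fun y => 0 <= y < 1) (locally x)) (locally (f x)).

(** All orders up to [k] are required: since [Derive] is total,
    [ex_derive_n f k] alone does not give the lower derivatives. *)
Definition Ck_on_01 (k : nat) (f : R -> R) : Prop :=
  forall (n : nat) (x : R), (n <= k)%nat -> 0 < x < 1 ->
    ex_derive_n f n x /\ continuous (Derive_n f n) x.

(** With [F] in C^4, [G] in C^3 and [Omega] in C^2, a field of conical form is
    twice continuously differentiable. *)
Definition classical_profiles (F G Omega : R -> R) : Prop :=
  (continuous_on_01 F /\ continuous_on_01 G /\ continuous_on_01 Omega)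
  /\ (Ck_on_01 4 F /\ Ck_on_01 3 G /\ Ck_on_01 2 Omega).

Definition ground_conditions (F G Omega : R -> R) : Prop :=
  F 0 = 0 /\ G 0 = 0 /\ Omega 0 = 0.

Definition axis_conditions (b : R) (F Omega : R -> R) (C_omega : R) : Prop :=
  filterlim Omega (at_left 1) (locally C_omega)
  /\ (b <> 2 ->
      filterlim (fun x => F x * Rpower (1 - x ^ 2) ((1 - b) / 2))
        (at_left 1) (locally 0)).

(* Main.v *)
Require Import Defs.
From Stdlib Require Import Reals Lra Lia.
From Coquelicot Require Import Coquelicot.
Open Scope R_scope.

(** The azimuthal momentum equation alone is contradictory. By axial symmetry of
    the velocity and periodicity of the pressure it contains no pressure term;
    its convective part scales as [R^(-2b-1)] and its viscous part as
    [R^(-b-2)], so for [b <> 1] both vanish. The viscous part says that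
    [w = Omega (1 - x^2)^((1-b)/2)] satisfies [(1 - x^2) w'' = b (1 - b) w].
    If [Omega] had a positive limit at [1], then for [b > 1] the function [w]
    would be concave near [1] and yet tend to infinity, and for [b < 1] it would
    be convex with limit [0], hence [O(1 - x)], whereas
    [(1 - x^2)^((1-b)/2)] decays more slowly. *)

(** * Cartesian description of the half-space off the axis *)

Lemma polar_angle_exists (x y : R) :
  0 < x ^ 2 + y ^ 2 ->
  exists theta, x = sqrt (x ^ 2 + y ^ 2) * cos theta
             /\ y = sqrt (x ^ 2 + y ^ 2) * sin theta.
Proof.
  intros H.
  set (r := sqrt (x ^ 2 + y ^ 2)).
  assert (Hr : 0 < r) by now apply sqrt_lt_R0.
  assert (Hr2 : r * r = x ^ 2 + y ^ 2) by (apply sqrt_sqrt; lra).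
  assert (Hx : -1 <= x / r <= 1).
  { split; [apply Rle_div_r | apply Rle_div_l]; nra. }
  assert (Hs : sqrt (1 - (x / r)²) = Rabs y / r).
  { rewrite <- (Rabs_pos_eq r) at 2 by lra.
    rewrite <- Rabs_div by lra.
    rewrite <- sqrt_Rsqr_abs. f_equal.
    unfold Rsqr. field_simplify; try lra.
    replace (r ^ 2) with (x ^ 2 + y ^ 2) by nra.
    f_equal. ring. }
  (* [acos] ranges over [[0, PI]], where the sine is nonnegative; the lower half-plane is reached by
     negating the angle. *)
  destruct (Rle_dec 0 y) as [Hy | Hy].
  - exists (acos (x / r)). rewrite cos_acos, sin_acos, Hs, Rabs_pos_eq by lra.
    split; field; lra.
  - exists (- acos (x / r)).
    rewrite cos_neg, sin_neg, cos_acos, sin_acos, Hs, Rabs_left by lra.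
    split; field; lra.
Qed.

(** Strict inequalities make openness visible, so that equalities valid on the domain can be
    differentiated. Conversely, the meridian angle comes from polar coordinates of [(x, y)], and
    [alpha = acos (z / rho)] lies strictly between [0] and [PI / 2] because its sine [r / rho] and
    its cosine [z / rho] are both positive. *)
Lemma half_space_off_axis_iff (x y z : R) :
  half_space_off_axis (x, y, z) <-> 0 < x ^ 2 + y ^ 2 /\ 0 < z.
Proof.
  split.
  - intros (rho & alpha & theta & Hrho & Ha & E). injection E as -> -> ->.
    assert (0 < sin alpha) by (apply sin_gt_0; lra).
    assert (0 < cos alpha) by (apply cos_gt_0; lra).
    split; [|now apply Rmult_lt_0_compat].
    replace (_ + _) with ((rho * sin alpha) ^ 2 * ((sin theta)² + (cos theta)²))
      by (unfold Rsqr; ring).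
    rewrite sin2_cos2, Rmult_1_r. apply pow_lt, Rmult_lt_0_compat; lra.
  - intros [Hs Hz].
    destruct (polar_angle_exists x y Hs) as (theta & Hx & Hy).
    set (r := sqrt (x ^ 2 + y ^ 2)) in *.
    assert (Hr : 0 < r) by now apply sqrt_lt_R0.
    destruct (polar_angle_exists z r) as (alpha' & Hz' & Hr'); [nra|].
    set (rho := sqrt (z ^ 2 + r ^ 2)) in *.
    assert (Hrho : 0 < rho) by (apply sqrt_lt_R0; nra).
    assert (Hrho2 : rho * rho = z ^ 2 + r ^ 2) by (apply sqrt_sqrt; nra).
    assert (Hb : 0 < z / rho < 1).
    { split; [now apply Rdiv_lt_0_compat | apply Rlt_div_l]; nra. }
    exists rho, (acos (z / rho)), theta.
    assert (Hsin : sin (acos (z / rho)) = r / rho).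
    { rewrite sin_acos by lra.
      rewrite <- (sqrt_Rsqr (r / rho)) by (apply Rlt_le, Rdiv_lt_0_compat; lra).
      f_equal. unfold Rsqr. field_simplify; try lra.
      f_equal. nra. }
    split; [exact Hrho|split].
    + split.
      * apply Rnot_le_lt. intros H0. pose proof (acos_bound (z / rho)).
        replace (acos (z / rho)) with 0 in Hsin by lra.
        rewrite sin_0 in Hsin. assert (0 < r / rho) by (apply Rdiv_lt_0_compat; lra). lra.
      * apply Rnot_le_lt. intros H0. pose proof (acos_bound (z / rho)).
        assert (cos (acos (z / rho)) <= 0) by (apply cos_le_0; lra).
        rewrite cos_acos in H1; lra.
    + unfold spherical. rewrite Hsin, cos_acos by lra.
      f_equal; [f_equal|field; lra].
      * rewrite Hx at 1. field; lra.
      * rewrite Hy at 1. field; lra.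
Qed.

(** * Cartesian derivatives of swirling fields *)

(* A horizontal velocity component of a swirling flow has the form
   [x * M + y * N] with [M], [N] functions of [s = x^2 + y^2] and [z]. *)
Definition C2_profile (M Ms Mss Mz Mzz : R -> R -> R) : Prop :=
  forall s z : R, 0 < s -> 0 < z ->
    is_derive (fun t => M t z) s (Ms s z)
    /\ is_derive (fun t => Ms t z) s (Mss s z)
    /\ is_derive (M s) z (Mz s z)
    /\ is_derive (Mz s) z (Mzz s z).

Lemma locally_pos_sum_sqr_l (x y : R) :
  0 < x ^ 2 + y ^ 2 -> locally x (fun t => 0 < t ^ 2 + y ^ 2).
Proof.
  intros H.
  apply (continuous_comp (fun t => t ^ 2 + y ^ 2) (fun u => u) x).
  - apply (@ex_derive_continuous R_AbsRing). now auto_derive.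
  - apply continuous_id.
  - now apply (open_gt 0).
Qed.

Lemma locally_pos_sum_sqr_r (x y : R) :
  0 < x ^ 2 + y ^ 2 -> locally y (fun t => 0 < x ^ 2 + t ^ 2).
Proof.
  rewrite Rplus_comm. intros H.
  generalize (locally_pos_sum_sqr_l y x H). apply filter_imp.
  intros t. now rewrite Rplus_comm.
Qed.

Lemma is_derive_partial (i : axis) (f : scalar_field) (x y z l : R) :
  match i with
  | ax_x => is_derive (fun t => f (t, y, z)) x l
  | ax_y => is_derive (fun t => f (x, t, z)) y l
  | ax_z => is_derive (fun t => f (x, y, t)) z l
  end -> partial i f (x, y, z) = l.
Proof. destruct i; apply is_derive_unique. Qed.

Section LinearTimesProfile.

Variables (M Ms Mss Mz Mzz N Ns Nss Nz Nzz : R -> R -> R) (f : scalar_field).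
Hypothesis HM : C2_profile M Ms Mss Mz Mzz.
Hypothesis HN : C2_profile N Ns Nss Nz Nzz.
Hypothesis Hf : forall x y z, 0 < x ^ 2 + y ^ 2 -> 0 < z ->
  f (x, y, z) = x * M (x ^ 2 + y ^ 2) z + y * N (x ^ 2 + y ^ 2) z.

(** [auto_derive] leaves [Derive] of the abstract profiles in its answer; the [is_derive] hypotheses
    in the context supply their values, and what remains is a polynomial identity. *)
Ltac auto_derive_with_hyps :=
  evar_last;
  [ auto_derive; [repeat split; eexists; eassumption | reflexivity]
  | repeat match goal with
           | E : is_derive _ _ _ |- _ => apply is_derive_unique in E
           end;
    simpl in *;
    repeat match goal with E : Derive _ _ = _ |- _ => rewrite E; clear E end;
    ring ].

Lemma partial_x_linear_profile (x y z : R) :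
  0 < x ^ 2 + y ^ 2 -> 0 < z ->
  partial ax_x f (x, y, z) =
    M (x ^ 2 + y ^ 2) z
    + 2 * x * (x * Ms (x ^ 2 + y ^ 2) z + y * Ns (x ^ 2 + y ^ 2) z).
Proof.
  intros Hs Hz. apply is_derive_partial.
  apply is_derive_ext_loc with
    (fun t => t * M (t ^ 2 + y ^ 2) z + y * N (t ^ 2 + y ^ 2) z).
  { generalize (locally_pos_sum_sqr_l x y Hs). apply filter_imp.
    intros t Ht. now rewrite Hf. }
  destruct (HM _ z Hs Hz) as (HMs & _), (HN _ z Hs Hz) as (HNs & _).
  auto_derive_with_hyps.
Qed.

Lemma partial_y_linear_profile (x y z : R) :
  0 < x ^ 2 + y ^ 2 -> 0 < z ->
  partial ax_y f (x, y, z) =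
    N (x ^ 2 + y ^ 2) z
    + 2 * y * (x * Ms (x ^ 2 + y ^ 2) z + y * Ns (x ^ 2 + y ^ 2) z).
Proof.
  intros Hs Hz. apply is_derive_partial.
  apply is_derive_ext_loc with
    (fun t => x * M (x ^ 2 + t ^ 2) z + t * N (x ^ 2 + t ^ 2) z).
  { generalize (locally_pos_sum_sqr_r x y Hs). apply filter_imp.
    intros t Ht. now rewrite Hf. }
  destruct (HM _ z Hs Hz) as (HMs & _), (HN _ z Hs Hz) as (HNs & _).
  auto_derive_with_hyps.
Qed.

Lemma partial_z_linear_profile (x y z : R) :
  0 < x ^ 2 + y ^ 2 -> 0 < z ->
  partial ax_z f (x, y, z) =
    x * Mz (x ^ 2 + y ^ 2) z + y * Nz (x ^ 2 + y ^ 2) z.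
Proof.
  intros Hs Hz. apply is_derive_partial.
  apply is_derive_ext_loc with
    (fun t => x * M (x ^ 2 + y ^ 2) t + y * N (x ^ 2 + y ^ 2) t).
  { generalize (open_gt 0 z Hz). apply filter_imp.
    intros t Ht. now rewrite Hf. }
  destruct (HM _ z Hs Hz) as (_ & _ & HMz & _), (HN _ z Hs Hz) as (_ & _ & HNz & _).
  apply (is_derive_plus (V := R_NormedModule)); now apply is_derive_scal.
Qed.

(** A function [M] of [s = x^2 + y^2] has planar Laplacian [4 * s * Mss + 4 * Ms]. The linear factor
    [x] adds the cross term [2 * (2 * x * Ms)], which raises the coefficient [4] of [Ms] to [8];
    likewise for [y * N]. *)
Lemma laplacian_linear_profile (x y z : R) :
  0 < x ^ 2 + y ^ 2 -> 0 < z ->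
  let L Ks Kss Kzz s := 4 * s * Kss s z + 8 * Ks s z + Kzz s z : R in
  laplacian f (x, y, z) =
    x * L Ms Mss Mzz (x ^ 2 + y ^ 2) + y * L Ns Nss Nzz (x ^ 2 + y ^ 2).
Proof.
  intros Hs Hz L. unfold laplacian, sum_axes.
  destruct (HM _ z Hs Hz) as (HMs & HMss & HMz & HMzz),
    (HN _ z Hs Hz) as (HNs & HNss & HNz & HNzz).
  set (D := x * Ms (x ^ 2 + y ^ 2) z + y * Ns (x ^ 2 + y ^ 2) z).
  set (E := x * Mss (x ^ 2 + y ^ 2) z + y * Nss (x ^ 2 + y ^ 2) z).
  rewrite (is_derive_partial ax_x _ x y z
    (2 * D + 4 * x * Ms (x ^ 2 + y ^ 2) z + 4 * x ^ 2 * E)).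
  2:{ eapply is_derive_ext_loc.
      { generalize (locally_pos_sum_sqr_l x y Hs). apply filter_imp.
        intros t Ht. symmetry. now apply partial_x_linear_profile. }
      unfold D, E. auto_derive_with_hyps. }
  rewrite (is_derive_partial ax_y _ x y z
    (2 * D + 4 * y * Ns (x ^ 2 + y ^ 2) z + 4 * y ^ 2 * E)).
  2:{ eapply is_derive_ext_loc.
      { generalize (locally_pos_sum_sqr_r x y Hs). apply filter_imp.
        intros t Ht. symmetry. now apply partial_y_linear_profile. }
      unfold D, E. auto_derive_with_hyps. }
  rewrite (is_derive_partial ax_z _ x y z
    (x * Mzz (x ^ 2 + y ^ 2) z + y * Nzz (x ^ 2 + y ^ 2) z)).
  2:{ eapply is_derive_ext_loc.
      { generalize (open_gt 0 z Hz). apply filter_imp.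
        intros t Ht. symmetry. now apply partial_z_linear_profile. }
      apply (is_derive_plus (V := R_NormedModule)); now apply is_derive_scal. }
  unfold L, D, E. ring.
Qed.

End LinearTimesProfile.

(** * Pressure on horizontal circles and the azimuthal momentum *)

(** The chain rule needs total differentiability of [p] in [(x, y)]. It follows from the
    x-derivative existing nearby and being continuous at the point, together with the y-derivative
    existing at the point. *)
Lemma is_derive_along_circle (p : scalar_field) (r z theta : R) :
  C1_on half_space_off_axis p -> 0 < r -> 0 < z ->
  let q := (r * cos theta, r * sin theta, z) in
  is_derive (fun t => p (r * cos t, r * sin t, z)) theta
    (r * cos theta * partial ax_y p q - r * sin theta * partial ax_x p q).
Proof.
  intros Hp Hr Hz q.
  set (x := r * cos theta). set (y := r * sin theta).
  assert (Hs : 0 < x ^ 2 + y ^ 2).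
  { unfold x, y. generalize (sin2_cos2 theta). unfold Rsqr. intros H.
    replace (_ + _) with (r ^ 2 * (sin theta * sin theta + cos theta * cos theta))
      by ring.
    rewrite H. nra. }
  assert (Hq : half_space_off_axis (x, y, z)) by now apply half_space_off_axis_iff.
  assert (Hd : filterdiff (fun u : R * R => p (fst u, snd u, z)) (locally (x, y))
    (fun u : R * R => fst u * partial ax_x p (x, y, z) + snd u * partial ax_y p (x, y, z))).
  { apply (is_derive_filterdiff (fun a b => p (a, b, z)) x y
      (fun a b => partial ax_x p (a, b, z))).
    - assert (Hopen : locally (x, y) (fun u : R * R => 0 < fst u ^ 2 + snd u ^ 2)).
      { apply (continuous_comp (fun u : R * R => fst u ^ 2 + snd u ^ 2) (fun c => c) (x, y)).
        - apply (continuous_plus (V := R_NormedModule));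
            apply (continuous_comp _ (fun t => t ^ 2)).
          + apply continuous_fst.
          + apply (@ex_derive_continuous R_AbsRing). now auto_derive.
          + apply continuous_snd.
          + apply (@ex_derive_continuous R_AbsRing). now auto_derive.
        - apply continuous_id.
        - now apply (open_gt 0). }
      revert Hopen. apply filter_imp. intros [a c] Hac. simpl fst in *. simpl snd in *.
      apply Derive_correct.
      now apply (Hp ax_x (a, c, z)), half_space_off_axis_iff.
    - apply Derive_correct. now apply (Hp ax_y (x, y, z)).
    - apply (continuous_comp (fun u : R * R => (fst u, snd u, z)) (partial ax_x p) (x, y)).
      + apply (continuous_comp_2 (fun u : R * R => (fst u, snd u)) (fun _ => z)
          (fun u c => (u, c)) (x, y)).
        * apply (continuous_ext (fun u => u)); [now intros []|apply continuous_id].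
        * apply continuous_const.
        * apply (continuous_ext (fun u => u)); [now intros []|apply continuous_id].
      + now apply (Hp ax_x (x, y, z)). }
  apply (filterdiff_differentiable_pt_lim (fun a c => p (a, c, z))) in Hd.
  apply is_derive_Reals.
  replace (_ - _) with (partial ax_x p (x, y, z) * (- y) + partial ax_y p (x, y, z) * x)
    by (unfold q, x, y; ring).
  apply (derivable_pt_lim_comp_2d (fun a c => p (a, c, z))); [exact Hd| |];
    apply is_derive_Reals; auto_derive; unfold x, y; trivial; ring.
Qed.

(* The circulation of a gradient along a closed circle vanishes. *)
Lemma constant_angular_derivative_eq0 (p : scalar_field) (r z K : R) :
  C1_on half_space_off_axis p -> 0 < r -> 0 < z ->
  (forall theta, let q := (r * cos theta, r * sin theta, z) in
     r * cos theta * partial ax_y p q - r * sin theta * partial ax_x p q = K) ->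
  K = 0.
Proof.
  intros Hp Hr Hz HK.
  assert (Hd : forall t, is_derive (fun t => p (r * cos t, r * sin t, z)) t K).
  { intros t. rewrite <- (HK t). now apply is_derive_along_circle. }
  destruct (MVT_gen (fun t => p (r * cos t, r * sin t, z)) 0 (2 * PI) (fun _ => K))
    as (c & _ & E).
  - intros t _. apply Hd.
  - intros t _. apply continuity_pt_filterlim.
    apply (@ex_derive_continuous R_AbsRing). now exists K.
  - rewrite cos_2PI, sin_2PI, cos_0, sin_0 in E.
    pose proof PI_RGT_0. nra.
Qed.

(* The theta-momentum equation, with [s = r^2], [A = v_r / r], [B = v_theta / r]
   in cylindrical coordinates. *)
Lemma azimuthal_momentum_equation (nu : R) (v : vector_field) (p : scalar_field)
    (A As Ass Az Azz B Bs Bss Bz Bzz W : R -> R -> R) :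
  C2_profile A As Ass Az Azz -> C2_profile B Bs Bss Bz Bzz ->
  (forall x y z, 0 < x ^ 2 + y ^ 2 -> 0 < z ->
     let s := x ^ 2 + y ^ 2 in
     v ax_x (x, y, z) = x * A s z - y * B s z
     /\ v ax_y (x, y, z) = x * B s z + y * A s z
     /\ v ax_z (x, y, z) = W s z) ->
  C1_on half_space_off_axis p ->
  steady_navier_stokes_on half_space_off_axis nu v p ->
  forall s z, 0 < s -> 0 < z ->
    2 * s * A s z * (B s z + s * Bs s z) + W s z * (s * Bz s z)
    = nu * s * (4 * s * Bss s z + 8 * Bs s z + Bzz s z).
Proof.
  intros HA HB Hv Hp HNS s z Hs Hz.
  assert (HB' : C2_profile (fun s z => - B s z) (fun s z => - Bs s z)
    (fun s z => - Bss s z) (fun s z => - Bz s z) (fun s z => - Bzz s z)).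
  { intros s' z' Hs' Hz'. destruct (HB s' z' Hs' Hz') as (H1 & H2 & H3 & H4).
    refine (conj _ (conj _ (conj _ _))); now apply (is_derive_opp (V := R_NormedModule)). }
  assert (Hvx : forall x y z, 0 < x ^ 2 + y ^ 2 -> 0 < z ->
    v ax_x (x, y, z) = x * A (x ^ 2 + y ^ 2) z + y * - B (x ^ 2 + y ^ 2) z).
  { intros x y z' H H'. destruct (Hv x y z' H H') as (-> & _). ring. }
  assert (Hvy : forall x y z, 0 < x ^ 2 + y ^ 2 -> 0 < z ->
    v ax_y (x, y, z) = x * B (x ^ 2 + y ^ 2) z + y * A (x ^ 2 + y ^ 2) z).
  { intros x y z' H H'. now apply Hv. }
  (* [x] times the y-equation minus [y] times the x-equation expresses the angular derivative of [p]
     as the viscous minus the convective terms. This depends on [s] and [z] only, hence is constant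
     along the circle of radius [sqrt s], and so vanishes. *)
  apply Rminus_diag_uniq. rewrite <- Ropp_minus_distr.
  apply Ropp_eq_0_compat.
  apply (constant_angular_derivative_eq0 p (sqrt s) z);
    [exact Hp | now apply sqrt_lt_R0 | exact Hz |].
  intros theta. cbv zeta.
  set (x := sqrt s * cos theta). set (y := sqrt s * sin theta).
  assert (E : x ^ 2 + y ^ 2 = s).
  { unfold x, y. transitivity ((sqrt s * sqrt s) * ((sin theta)² + (cos theta)²)).
    - unfold Rsqr. ring.
    - rewrite sin2_cos2, sqrt_sqrt; lra. }
  assert (H : 0 < x ^ 2 + y ^ 2) by now rewrite E.
  destruct (HNS (x, y, z)) as (NS & _); [now apply half_space_off_axis_iff|].
  pose proof (NS ax_x) as NSx. pose proof (NS ax_y) as NSy.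
  unfold convective, sum_axes in NSx, NSy.
  destruct (Hv x y z H Hz) as (Ex & Ey & Ez). cbv zeta in Ex, Ey, Ez.
  rewrite (partial_x_linear_profile _ _ _ _ _ _ _ _ _ _ _ HA HB' Hvx) in NSx by easy.
  rewrite (partial_y_linear_profile _ _ _ _ _ _ _ _ _ _ _ HA HB' Hvx) in NSx by easy.
  rewrite (partial_z_linear_profile _ _ _ _ _ _ _ _ _ _ _ HA HB' Hvx) in NSx by easy.
  rewrite (laplacian_linear_profile _ _ _ _ _ _ _ _ _ _ _ HA HB' Hvx) in NSx by easy.
  rewrite (partial_x_linear_profile _ _ _ _ _ _ _ _ _ _ _ HB HA Hvy) in NSy by easy.
  rewrite (partial_y_linear_profile _ _ _ _ _ _ _ _ _ _ _ HB HA Hvy) in NSy by easy.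
  rewrite (partial_z_linear_profile _ _ _ _ _ _ _ _ _ _ _ HB HA Hvy) in NSy by easy.
  rewrite (laplacian_linear_profile _ _ _ _ _ _ _ _ _ _ _ HB HA Hvy) in NSy by easy.
  rewrite Ex, Ey, Ez, E in NSx, NSy.
  match type of NSx with ?lhs = - ?px + ?rhs =>
    replace px with (rhs - lhs) by lra end.
  match type of NSy with ?lhs = - ?py + ?rhs =>
    replace py with (rhs - lhs) by lra end.
  clear NSx NSy Ex Ey Ez NS H Hs. clearbody x y.
  generalize (A s z) (As s z) (Ass s z) (Az s z) (Azz s z) (B s z) (Bs s z)
    (Bss s z) (Bz s z) (Bzz s z) (W s z). intros.
  subst s. ring.
Qed.

(** * Calculus of homogeneous axisymmetric functions *)

(* Homogeneous of degree [2 * m] in [(r, z)]; here [s = r^2], so that the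
   argument of [h] is [x = cos alpha]. *)
Definition conical (m : R) (h : R -> R) (s z : R) : R :=
  h (z / sqrt (s + z ^ 2)) * Rpower (s + z ^ 2) m.

Lemma cos_polar_bound (s z : R) :
  0 < s -> 0 < z -> 0 < z / sqrt (s + z ^ 2) < 1.
Proof.
  intros Hs Hz.
  assert (Hq : 0 < sqrt (s + z ^ 2)) by (apply sqrt_lt_R0; nra).
  assert (sqrt (s + z ^ 2) * sqrt (s + z ^ 2) = s + z ^ 2) by (apply sqrt_sqrt; nra).
  split; [now apply Rdiv_lt_0_compat | apply Rlt_div_l; nra].
Qed.

Lemma Rpower_minus1 (t m : R) : 0 < t -> Rpower t (m - 1) = Rpower t m / t.
Proof.
  intros Ht. unfold Rminus. rewrite Rpower_plus, Rpower_Ropp, Rpower_1; auto.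
Qed.

Lemma Rpower_minus_half (t m : R) :
  0 < t -> Rpower t (m - / 2) = Rpower t m / sqrt t.
Proof.
  intros Ht. unfold Rminus. rewrite Rpower_plus, Rpower_Ropp, Rpower_sqrt; auto.
Qed.

Section ConicalDerivatives.

Variables (h : R -> R) (m : R).

(** Angular profiles of the [s]- and [z]-derivatives of [conical m h]. With [T = s + z^2] and
    [u = z / sqrt T], one has [du/ds = - u / (2 * T)] and [du/dz = (1 - u^2) / sqrt T]; the exponent
    of [T] drops by [1] and by [/ 2] respectively. *)
Definition conical_ds (u : R) : R := m * h u - u / 2 * Derive h u.
Definition conical_dz (u : R) : R := (1 - u ^ 2) * Derive h u + 2 * m * u * h u.

Variables (s z : R).
Hypotheses (Hs : 0 < s) (Hz : 0 < z).
Hypothesis Hh : forall u, 0 < u < 1 -> ex_derive h u.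

Lemma is_derive_conical_s :
  is_derive (fun t => conical m h t z) s (conical (m - 1) conical_ds s z).
Proof.
  unfold conical.
  assert (Ht : 0 < s + z ^ 2) by nra.
  pose proof (cos_polar_bound s z Hs Hz) as Hu.
  assert (Hq : 0 < sqrt (s + z ^ 2)) by now apply sqrt_lt_R0.
  assert (Hq2 : sqrt (s + z ^ 2) * sqrt (s + z ^ 2) = s + z ^ 2) by (apply sqrt_sqrt; lra).
  rewrite Rpower_minus1 by easy.
  unfold conical_ds, Rpower.
  evar_last.
  { auto_derive; [|reflexivity]. simpl pow in *.
    repeat split; try easy; try (apply Hh; easy); lra. }
  unfold Rdiv in *. simpl pow in *.
  set (q := sqrt (s + z * (z * 1))) in *.
  change (fun x => h x) with h.
  set (e := exp _). set (d := Derive h _). set (hu := h _).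
  rewrite <- Hq2. field. lra.
Qed.

Lemma is_derive_conical_z :
  is_derive (conical m h s) z (conical (m - / 2) conical_dz s z).
Proof.
  unfold conical.
  assert (Ht : 0 < s + z ^ 2) by nra.
  pose proof (cos_polar_bound s z Hs Hz) as Hu.
  assert (Hq : 0 < sqrt (s + z ^ 2)) by now apply sqrt_lt_R0.
  assert (Hq2 : sqrt (s + z ^ 2) * sqrt (s + z ^ 2) = s + z ^ 2) by (apply sqrt_sqrt; lra).
  rewrite Rpower_minus_half by easy.
  unfold conical_dz, Rpower.
  evar_last.
  { auto_derive; [|reflexivity]. simpl pow in *.
    repeat split; try easy; try (apply Hh; easy); lra. }
  unfold Rdiv in *. simpl pow in *.
  set (q := sqrt (s + z * (z * 1))) in *.
  change (fun x => h x) with h.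
  set (e := exp _). set (d := Derive h _). set (hu := h _).
  replace s with (q * q - z * z) by lra.
  field. repeat split; nra.
Qed.

End ConicalDerivatives.

Lemma ex_derive_conical_ds (h : R -> R) (m : R) (u : R) :
  ex_derive h u -> ex_derive (Derive h) u -> ex_derive (conical_ds h m) u.
Proof. intros H1 H2. unfold conical_ds. auto_derive. now repeat split. Qed.

Lemma ex_derive_conical_dz (h : R -> R) (m : R) (u : R) :
  ex_derive h u -> ex_derive (Derive h) u -> ex_derive (conical_dz h m) u.
Proof. intros H1 H2. unfold conical_dz. auto_derive. now repeat split. Qed.

(** * Second derivatives and regularity of the profiles *)

Definition twice_derivable_on_01 (h : R -> R) : Prop :=
  forall u, 0 < u < 1 -> ex_derive h u /\ ex_derive (Derive h) u.

(** For the flow, [P] is [r * v_r] or [r * v_theta]; dividing by [s = r^2] gives the coefficients of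
    [x] and [y] in the Cartesian components. The formulas are the quotient rule. *)
Lemma conical_div_C2_profile (h : R -> R) (m : R) :
  twice_derivable_on_01 h ->
  let P := conical m h in
  let Ps := conical (m - 1) (conical_ds h m) in
  let Pss := conical (m - 1 - 1) (conical_ds (conical_ds h m) (m - 1)) in
  let Pz := conical (m - / 2) (conical_dz h m) in
  let Pzz := conical (m - / 2 - / 2) (conical_dz (conical_dz h m) (m - / 2)) in
  C2_profile (fun s z => P s z / s)
    (fun s z => Ps s z / s - P s z / s ^ 2)
    (fun s z => Pss s z / s - 2 * Ps s z / s ^ 2 + 2 * P s z / s ^ 3)
    (fun s z => Pz s z / s)
    (fun s z => Pzz s z / s).
Proof.
  intros Hh P Ps Pss Pz Pzz s z Hs Hz.
  assert (H1 : is_derive (fun t => P t z) s (Ps s z)).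
  { apply is_derive_conical_s; try easy. intros; now apply Hh. }
  assert (H2 : is_derive (fun t => Ps t z) s (Pss s z)).
  { apply is_derive_conical_s; try easy.
    intros; apply ex_derive_conical_ds; now apply Hh. }
  assert (H3 : is_derive (P s) z (Pz s z)).
  { apply is_derive_conical_z; try easy. intros; now apply Hh. }
  assert (H4 : is_derive (Pz s) z (Pzz s z)).
  { apply is_derive_conical_z; try easy.
    intros; apply ex_derive_conical_dz; now apply Hh. }
  clearbody P Ps Pss Pz Pzz.
  assert (s <> 0) by lra.
  assert (s ^ 2 <> 0) by nra.
  refine (conj _ (conj _ (conj _ _))).
  - evar_last.
    { auto_derive; [|reflexivity]. repeat split; try easy. now exists (Ps s z). }
    apply is_derive_unique in H1. simpl in *. rewrite H1. field. easy.
  - evar_last.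
    { auto_derive; [|reflexivity]. repeat split; try easy; eexists; eassumption. }
    apply is_derive_unique in H1. simpl in *. rewrite H1.
    apply is_derive_unique in H2. simpl in *. rewrite H2. field. easy.
  - evar_last.
    { auto_derive; [|reflexivity]. repeat split; try easy; eexists; eassumption. }
    apply is_derive_unique in H3. simpl in *.
    change (fun x : R => P s x) with (P s). rewrite H3. field. easy.
  - evar_last.
    { auto_derive; [|reflexivity]. repeat split; try easy; eexists; eassumption. }
    apply is_derive_unique in H4. simpl in *.
    change (fun x : R => Pz s x) with (Pz s). rewrite H4. field. easy.
Qed.

(* [4 s P_ss + P_zz] is [P_rr - P_r / r + P_zz]. *)
Lemma conical_elliptic_operator (h : R -> R) (m u : R) :
  ex_derive h u -> ex_derive (Derive h) u ->
  4 * (1 - u ^ 2) * conical_ds (conical_ds h m) (m - 1) u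
  + conical_dz (conical_dz h m) (m - / 2) u
  = (1 - u ^ 2) * Derive (Derive h) u + 2 * m * (2 * m - 1) * h u.
Proof.
  intros H1 H2.
  assert (Es : Derive (conical_ds h m) u
    = m * Derive h u - / 2 * Derive h u - u / 2 * Derive (Derive h) u).
  { apply is_derive_unique. unfold conical_ds. auto_derive; [now repeat split|].
    change (fun x => h x) with h. change (fun x => Derive h x) with (Derive h). field. }
  assert (Ez : Derive (conical_dz h m) u
    = - 2 * u * Derive h u + (1 - u ^ 2) * Derive (Derive h) u
      + 2 * m * h u + 2 * m * u * Derive h u).
  { apply is_derive_unique. unfold conical_dz. auto_derive; [now repeat split|].
    change (fun x => h x) with h. change (fun x => Derive h x) with (Derive h). ring. }
  unfold conical_ds at 1, conical_dz at 1. rewrite Es, Ez.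
  unfold conical_ds, conical_dz. field.
Qed.

(** [Derive h] agrees with [h1] only inside [(0, 1)], which is enough because the interval is open
    and derivability is local. *)
Lemma twice_derivable_on_01_intro (h h1 : R -> R) :
  (forall u, 0 < u < 1 -> is_derive h u (h1 u) /\ ex_derive h1 u) ->
  twice_derivable_on_01 h.
Proof.
  intros H u Hu. split; [now exists (h1 u); apply H|].
  apply ex_derive_ext_loc with h1; [|now apply H].
  generalize (filter_and _ _ (open_gt 0 u (proj1 Hu)) (open_lt 1 u (proj2 Hu))).
  apply filter_imp. intros t Ht. symmetry. now apply is_derive_unique, H.
Qed.

Lemma twice_derivable_on_01_plus (f g : R -> R) :
  twice_derivable_on_01 f -> twice_derivable_on_01 g ->
  twice_derivable_on_01 (fun u => f u + g u).
Proof.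
  intros Hf Hg. apply twice_derivable_on_01_intro with (fun u => Derive f u + Derive g u).
  intros u Hu. destruct (Hf u Hu), (Hg u Hu).
  split; auto_derive; try (now repeat split).
  change (fun x => f x) with f. change (fun x => g x) with g. ring.
Qed.

Lemma twice_derivable_on_01_mult (f g : R -> R) :
  twice_derivable_on_01 f -> twice_derivable_on_01 g ->
  twice_derivable_on_01 (fun u => f u * g u).
Proof.
  intros Hf Hg.
  apply twice_derivable_on_01_intro with (fun u => Derive f u * g u + f u * Derive g u).
  intros u Hu. destruct (Hf u Hu), (Hg u Hu).
  split; auto_derive; try (now repeat split).
  change (fun x => f x) with f. change (fun x => g x) with g. ring.
Qed.

Lemma twice_derivable_on_01_id : twice_derivable_on_01 (fun u => u).
Proof.
  apply twice_derivable_on_01_intro with (fun _ => 1).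
  intros u _. split; now auto_derive.
Qed.

Lemma twice_derivable_on_01_Rpower (m : R) :
  twice_derivable_on_01 (fun u => Rpower (1 - u ^ 2) m).
Proof.
  apply twice_derivable_on_01_intro with
    (fun u => m * (- 2 * u) / (1 - u ^ 2) * Rpower (1 - u ^ 2) m).
  intros u Hu. assert (0 < 1 - u ^ 2) by nra. unfold Rpower.
  split; auto_derive; simpl pow in *; try (repeat split; trivial; unfold Rminus in *; lra).
Qed.

Lemma twice_derivable_on_01_sqrt :
  twice_derivable_on_01 (fun u => sqrt (1 - u ^ 2)).
Proof.
  apply twice_derivable_on_01_intro with (fun u => - u / sqrt (1 - u ^ 2)).
  intros u Hu. assert (0 < 1 - u ^ 2) by nra.
  assert (0 < sqrt (1 - u ^ 2)) by now apply sqrt_lt_R0.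
  split; auto_derive; simpl pow in *; try (repeat split; trivial; unfold Rminus in *; lra).
  unfold Rminus in *. field. lra.
Qed.

Lemma Ck_twice_derivable_on_01 (k : nat) (f : R -> R) :
  (2 <= k)%nat -> Ck_on_01 k f -> twice_derivable_on_01 f.
Proof.
  intros Hk Hf u Hu. split.
  - apply (Hf 1%nat u); [lia|easy].
  - apply (Hf 2%nat u); [lia|easy].
Qed.

(* Converts a profile written relative to a power of [s = r^2] into one written
   relative to a power of [R^2 = s + z^2]. *)
Definition weighted (m : R) (f : R -> R) (u : R) : R := f u * Rpower (1 - u ^ 2) m.

(** Since [s = (1 - u^2) * (s + z^2)] for [u = z / sqrt (s + z^2)], the weight and the power of
    [s + z^2] combine into a power of [s]. *)
Lemma conical_weighted (m : R) (f : R -> R) (s z : R) :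
  0 < s -> 0 < z ->
  conical m (weighted m f) s z = f (z / sqrt (s + z ^ 2)) * Rpower s m.
Proof.
  intros Hs Hz. pose proof (cos_polar_bound s z Hs Hz) as Hu.
  assert (Ht : 0 < s + z ^ 2) by nra.
  assert (Hq2 : sqrt (s + z ^ 2) * sqrt (s + z ^ 2) = s + z ^ 2) by (apply sqrt_sqrt; lra).
  assert (Hq : 0 < sqrt (s + z ^ 2)) by now apply sqrt_lt_R0.
  unfold conical, weighted. rewrite Rmult_assoc, Rpower_mult_distr; [|nra|easy].
  do 2 f_equal. rewrite <- Hq2 at 2. field_simplify; [|lra]. simpl pow in *. lra.
Qed.

(** Points with fixed [u = cos alpha] and varying [T = R^2] form a ray from the origin. Restricting
    to it isolates the power of [T], so that terms of different homogeneity can be separated. *)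
Lemma conical_on_ray (m : R) (h : R -> R) (T u : R) :
  0 < T -> 0 < u < 1 ->
  conical m h ((1 - u ^ 2) * T) (u * sqrt T) = h u * Rpower T m.
Proof.
  intros HT Hu. assert (Hq2 : sqrt T * sqrt T = T) by (apply sqrt_sqrt; lra).
  assert (Hq : 0 < sqrt T) by now apply sqrt_lt_R0.
  unfold conical.
  replace ((1 - u ^ 2) * T + (u * sqrt T) ^ 2) with T
    by (rewrite <- Hq2 at 2; rewrite <- Hq2 at 1; ring).
  f_equal. f_equal. field. lra.
Qed.

(** * The swirl equation of a conical flow *)

Section ConicalFlow.

Variables (nu b : R) (F G Omega : R -> R) (v : vector_field) (p : scalar_field).
Hypothesis hnu : 0 < nu.
Hypothesis hb1 : b <> 1.
Hypothesis Hcl : classical_profiles F G Omega.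
Hypothesis Hv : has_conical_form b F G Omega v.
Hypothesis Hp : C1_on half_space_off_axis p.
Hypothesis HNS : steady_navier_stokes_on half_space_off_axis nu v p.

(** Chosen so that [r * v_theta = Omega * r^(1-b) = Omega * s^m]. *)
Let m := (1 - b) / 2.
(** Cylindrical components of the meridional velocity, up to the factor [r^(-b)]: [u] is [cos alpha]
    and [sqrt (1 - u^2)] is [sin alpha]. *)
Definition radial_profile (u : R) : R := G u * sqrt (1 - u ^ 2) + F u * u.
Definition vertical_profile (u : R) : R := G u * u - F u * sqrt (1 - u ^ 2).

Lemma conical_flow_cartesian (x y z : R) :
  0 < x ^ 2 + y ^ 2 -> 0 < z ->
  let s := x ^ 2 + y ^ 2 in
  let A := conical m (weighted m radial_profile) s z / s in
  let B := conical m (weighted m Omega) s z / s in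
  v ax_x (x, y, z) = x * A - y * B
  /\ v ax_y (x, y, z) = x * B + y * A
  /\ v ax_z (x, y, z) = conical (- b / 2) (weighted (- b / 2) vertical_profile) s z.
Proof.
  intros Hs Hz s A B. unfold A, B. rewrite !conical_weighted by easy.
  destruct (proj2 (half_space_off_axis_iff x y z) (conj Hs Hz))
    as (rho & alpha & theta & Hrho & Ha & E).
  rewrite E, !(Hv rho alpha theta Hrho Ha).
  injection E as Ex Ey Ez.
  assert (Hsin : 0 < sin alpha) by (apply sin_gt_0; lra).
  set (r := rho * sin alpha) in *.
  assert (Hr : 0 < r) by now apply Rmult_lt_0_compat.
  pose proof (sin2_cos2 theta) as Ht. pose proof (sin2_cos2 alpha) as Hal.
  unfold Rsqr in Ht, Hal.
  assert (Es : s = r * r).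
  { unfold s. rewrite Ex, Ey.
    transitivity (r * r * (sin theta * sin theta + cos theta * cos theta)); [ring|].
    rewrite Ht. ring. }
  assert (Eq : sqrt (s + z ^ 2) = rho).
  { rewrite Es, Ez. unfold r.
    replace (_ + _) with (rho * rho * (sin alpha * sin alpha + cos alpha * cos alpha))
      by ring.
    rewrite Hal, Rmult_1_r. apply sqrt_square. lra. }
  assert (Eu : z / sqrt (s + z ^ 2) = cos alpha).
  { rewrite Eq, Ez. field. lra. }
  rewrite Eu.
  assert (Esin : sqrt (1 - cos alpha ^ 2) = sin alpha).
  { replace (1 - cos alpha ^ 2) with (sin alpha * sin alpha) by (rewrite <- Hal; ring).
    apply sqrt_square. lra. }
  assert (Hpow : 0 < Rpower r b) by apply exp_pos.
  assert (Em : Rpower s m = r / Rpower r b).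
  { rewrite Es, <- Rpower_mult_distr, <- Rpower_plus by easy.
    replace (m + m) with (1 + - b) by (unfold m; field).
    rewrite Rpower_plus, Rpower_Ropp, Rpower_1; easy. }
  assert (Eb : Rpower s (- b / 2) = / Rpower r b).
  { rewrite Es, <- Rpower_mult_distr, <- Rpower_plus by easy.
    rewrite <- Rpower_Ropp. f_equal. field. }
  rewrite Em, Eb. unfold radial_profile, vertical_profile. rewrite Esin, Es, Ex, Ey.
  simpl. fold r. repeat split; field; lra.
Qed.

Lemma twice_derivable_weighted (k : R) (f : R -> R) :
  twice_derivable_on_01 f -> twice_derivable_on_01 (weighted k f).
Proof.
  intros H. apply twice_derivable_on_01_mult; [easy|apply twice_derivable_on_01_Rpower].
Qed.

Lemma swirl_ode (u : R) :
  0 < u < 1 ->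
  (1 - u ^ 2) * Derive (Derive (weighted m Omega)) u
  = b * (1 - b) * weighted m Omega u.
Proof.
  intros Hu. destruct Hcl as (_ & HF & HG & HO).
  apply Ck_twice_derivable_on_01 in HF, HG, HO; [|lia..].
  assert (Hsw : twice_derivable_on_01 (weighted m Omega))
    by now apply twice_derivable_weighted.
  assert (Hrad : twice_derivable_on_01 (weighted m radial_profile)).
  { apply twice_derivable_weighted, twice_derivable_on_01_plus;
      apply twice_derivable_on_01_mult; try easy.
    - apply twice_derivable_on_01_sqrt.
    - apply twice_derivable_on_01_id. }
  set (h := weighted m Omega) in *. set (g := weighted m radial_profile) in *.
  set (k := weighted (- b / 2) vertical_profile).
  pose proof (azimuthal_momentum_equation nu v p _ _ _ _ _ _ _ _ _ _
    (conical (- b / 2) k) (conical_div_C2_profile g m Hrad)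
    (conical_div_C2_profile h m Hsw) conical_flow_cartesian Hp HNS) as Heq.
  (* [K1] and [K2] are the convective and viscous coefficients on the ray. With [B = P / s], the
     convective factor [B + s * Bs] is [Ps], and the viscous term [s * (4 * s * Bss + 8 * Bs + Bzz)]
     reduces to [4 * s * Pss + Pzz]. *)
  set (K1 := 2 * g u * conical_ds h m u + k u * conical_dz h m u).
  set (K2 := 4 * (1 - u ^ 2) * conical_ds (conical_ds h m) (m - 1) u
             + conical_dz (conical_dz h m) (m - / 2) u).
  assert (HK : forall T, 0 < T -> K1 * Rpower T (- b) = nu * K2 * Rpower T (- (1 + b) / 2)).
  { intros T HT. assert (Hs : 0 < (1 - u ^ 2) * T) by (apply Rmult_lt_0_compat; nra).
    assert (Hz : 0 < u * sqrt T) by (apply Rmult_lt_0_compat; [easy|now apply sqrt_lt_R0]).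
    specialize (Heq _ _ Hs Hz). cbv beta in Heq.
    rewrite !conical_on_ray in Heq by easy.
    assert (E1 : Rpower T m * Rpower T (m - 1) = Rpower T (- b)).
    { rewrite <- Rpower_plus. f_equal. unfold m. field. }
    assert (E2 : Rpower T (- b / 2) * Rpower T (m - / 2) = Rpower T (- b)).
    { rewrite <- Rpower_plus. f_equal. unfold m. field. }
    assert (E3 : Rpower T (m - 1 - 1) = Rpower T (- (1 + b) / 2) / T).
    { rewrite Rpower_minus1 by easy. do 2 f_equal. unfold m. field. }
    assert (E4 : Rpower T (m - / 2 - / 2) = Rpower T (- (1 + b) / 2)).
    { f_equal. unfold m. field. }
    rewrite E3, E4 in Heq. unfold K1, K2.
    rewrite Rmult_plus_distr_r. rewrite <- E1 at 1. rewrite <- E2.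
    assert (HT0 : T <> 0) by lra. assert (Hu0 : 1 - u ^ 2 <> 0) by nra.
    match type of Heq with ?l = ?r => transitivity l; [|transitivity r; [exact Heq|]] end;
      field; split; easy. }
  (* Two values of [T] suffice: [T = 1] gives [K1 = nu * K2], and then [T = 2] forces [K2 = 0],
     since [- b] and [- (1 + b) / 2] coincide only for [b = 1]. *)
  assert (HK2 : K2 = 0).
  { pose proof (HK 1 Rlt_0_1) as H1. pose proof (HK 2 Rlt_0_2) as H2.
    assert (Hp1 : forall e, Rpower 1 e = 1).
    { intros e. unfold Rpower. rewrite ln_1, Rmult_0_r. apply exp_0. }
    rewrite !Hp1, !Rmult_1_r in H1. rewrite H1 in H2.
    assert (Hne : Rpower 2 (- b) <> Rpower 2 (- (1 + b) / 2)).
    { intros E. apply exp_inv in E. pose proof ln_lt_2. nra. }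
    apply Rmult_eq_reg_l with (nu * (Rpower 2 (- b) - Rpower 2 (- (1 + b) / 2))); [lra|].
    apply Rmult_integral_contrapositive. split; lra. }
  (* For this [m], [2 * m * (2 * m - 1)] equals [- b * (1 - b)]. *)
  unfold K2 in HK2. destruct (Hsw u Hu).
  rewrite conical_elliptic_operator in HK2 by easy.
  unfold m in HK2. lra.
Qed.

End ConicalFlow.

(** * Behaviour of the swirl at the axis *)

Lemma at_left_1_intro (x0 : R) (P : R -> Prop) :
  x0 < 1 -> (forall x, x0 < x < 1 -> P x) -> at_left 1 P.
Proof.
  intros H HP. unfold at_left, within. generalize (open_gt x0 1 H). apply filter_imp.
  intros x H1 H2. now apply HP.
Qed.

Lemma at_left_1_elim (P : R -> Prop) :
  at_left 1 P -> exists x0, 0 < x0 < 1 /\ forall x, x0 <= x < 1 -> P x.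
Proof.
  intros [d Hd].
  (* [1 / 2] keeps the point positive; [d / 2] instead of [d] puts the closed endpoint inside the
     ball. *)
  exists (Rmax (1 / 2) (1 - d / 2)). pose proof (cond_pos d).
  pose proof (Rmax_l (1 / 2) (1 - d / 2)). pose proof (Rmax_r (1 / 2) (1 - d / 2)).
  split.
  - split; [lra|apply Rmax_lub_lt; lra].
  - intros x Hx. apply Hd; [|lra].
    change (Rabs (x - 1) < d). rewrite Rabs_left; lra.
Qed.

Lemma filterlim_Rpower_at_left_1 (e : R) :
  0 < e -> filterlim (fun x => Rpower (1 - x ^ 2) e) (at_left 1) (locally 0).
Proof.
  intros He. apply filterlim_locally. intros eps.
  (* [d] solves [d^e = eps], and [1 - x^2 < 2 * (1 - x) < d] once [x > 1 - d / 2]. *)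
  set (d := Rpower eps (/ e)). assert (Hd : 0 < d) by apply exp_pos.
  apply at_left_1_intro with (Rmax 0 (1 - d / 2)).
  { apply Rmax_lub_lt; lra. }
  intros x [Hx Hx1].
  pose proof (Rmax_l 0 (1 - d / 2)). pose proof (Rmax_r 0 (1 - d / 2)).
  change (Rabs (Rpower (1 - x ^ 2) e - 0) < eps).
  rewrite Rminus_0_r, Rabs_pos_eq by (apply Rlt_le, exp_pos).
  replace (pos eps) with (Rpower d e).
  - apply Rlt_Rpower_l; [easy|]. split; nra.
  - unfold d. rewrite Rpower_mult, Rinv_l, Rpower_1; [easy|apply cond_pos|lra].
Qed.

Lemma mean_value_01 (f : R -> R) (x y : R) :
  (forall u, 0 < u < 1 -> ex_derive f u) -> 0 < x -> x <= y -> y < 1 ->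
  exists c, x <= c <= y /\ f y - f x = Derive f c * (y - x).
Proof.
  intros Hf Hx Hxy Hy.
  destruct (MVT_gen f x y (Derive f)) as (c & Hc & E);
    rewrite ?Rmin_left, ?Rmax_right in * by easy.
  - intros t Ht. apply Derive_correct, Hf. lra.
  - intros t Ht. apply continuity_pt_filterlim, (@ex_derive_continuous R_AbsRing), Hf. lra.
  - now exists c.
Qed.

(* The solutions of [(1 - x^2) w'' = b (1 - b) w] behave at [x = 1] like
   [1] or [1 - x], never like [(1 - x^2)^((1-b)/2)] with positive [b <> 1]. *)
Lemma swirl_limit_nonpos (b C : R) (Omega : R -> R) :
  0 < b -> b <> 1 ->
  let w := weighted ((1 - b) / 2) Omega in
  twice_derivable_on_01 w ->
  (forall u, 0 < u < 1 -> (1 - u ^ 2) * Derive (Derive w) u = b * (1 - b) * w u) ->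
  filterlim Omega (at_left 1) (locally C) ->
  C <= 0.
Proof.
  intros Hb Hb1 w Hw Hode Hlim.
  apply Rnot_lt_le. intros HC.
  assert (Hpos : at_left 1 (fun x => 0 < Omega x)) by (apply Hlim, (open_gt 0 C HC)).
  apply at_left_1_elim in Hpos. destruct Hpos as (x0 & Hx0 & Hpos).
  assert (Hwpos : forall x, x0 <= x < 1 -> 0 < w x).
  { intros x Hx. apply Rmult_lt_0_compat; [now apply Hpos|apply exp_pos]. }
  assert (Hode' : forall x, 0 < x < 1 ->
    Derive (Derive w) x = b * (1 - b) * (w x / (1 - x ^ 2))).
  { intros x Hx. assert (1 - x ^ 2 <> 0) by nra.
    apply Rmult_eq_reg_l with (1 - x ^ 2); [|easy].
    rewrite Hode by easy. field. easy. }
  assert (Hquo : forall x, x0 <= x < 1 -> 0 < b * (w x / (1 - x ^ 2))).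
  { intros x Hx. apply Rmult_lt_0_compat; [easy|].
    apply Rdiv_lt_0_compat; [now apply Hwpos|nra]. }
  assert (Hinv : forall x, 0 < x < 1 ->
    Omega x = w x * Rpower (1 - x ^ 2) (- ((1 - b) / 2))).
  { intros x Hx. unfold w, weighted.
    rewrite Rmult_assoc, <- Rpower_plus, Rplus_opp_r, Rpower_O by nra. ring. }
  set (M := Rabs (Derive w x0)).
  assert (HM : - M <= Derive w x0 <= M) by (unfold M; split_Rabs; lra).
  (* Such a bound forces [Omega] to have a limit at most [0], against [C > 0]. *)
  assert (Hbound : exists e M', 0 < e /\ forall x, x0 < x < 1 ->
    Omega x <= M' * Rpower (1 - x ^ 2) e).
  { destruct (Rlt_le_dec b 1) as [Hlt | Hle].
    (* Case [b < 1]: [w] is convex on [[x0, 1)], so [w'] stays above [- M]. Letting [y] tend to [1],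
       where [w y] tends to [C * 0], yields [w x <= M * (1 - x) <= M * (1 - x^2)]; dividing by the
       weight leaves the exponent [(1 + b) / 2]. *)
    - exists (1 - (1 - b) / 2), M. split; [lra|]. intros x Hx.
      assert (Hchord : forall y, x < y < 1 -> w x <= w y + M * (1 - x)).
      { intros y Hy.
        destruct (mean_value_01 w x y) as (c & Hc & E); [apply Hw|lra..|].
        destruct (mean_value_01 (Derive w) x0 c) as (d & Hd & E'); [apply Hw|lra..|].
        rewrite Hode' in E' by lra.
        assert (Hd' : x0 <= d < 1) by lra. specialize (Hquo d Hd').
        assert (0 <= (1 - b) * (b * (w d / (1 - d ^ 2))) * (c - x0))
          by (apply Rmult_le_pos; [apply Rmult_le_pos|]; lra).
        pose proof (Rmult_le_pos (Derive w c + M) (y - x) ltac:(lra) ltac:(lra)).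
        pose proof (Rmult_le_pos M (1 - y) (Rabs_pos _) ltac:(lra)).
        lra. }
      assert (Hwx : w x <= 0 + M * (1 - x)).
      { refine (filterlim_le (F := at_left 1) (fun _ => w x) (fun y => w y + M * (1 - x))
          (w x) (0 + M * (1 - x)) _ _ _).
        - now apply at_left_1_intro with x.
        - apply filterlim_const.
        - apply (filterlim_comp_2 (G := locally 0) (H := locally (M * (1 - x)))).
          + replace 0 with (C * 0) by ring.
            apply (filterlim_comp_2 (G := locally C) (H := locally 0) Omega
              (fun y => Rpower (1 - y ^ 2) ((1 - b) / 2)) Rmult);
              [exact Hlim| |apply (filterlim_mult C 0)].
            apply filterlim_Rpower_at_left_1. lra.
          + apply filterlim_const.
          + apply (filterlim_plus 0 (M * (1 - x))). }
      rewrite Hinv by lra.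
      replace (1 - (1 - b) / 2) with (1 + - ((1 - b) / 2)) by ring.
      rewrite Rpower_plus, Rpower_1, <- Rmult_assoc by nra.
      apply Rmult_le_compat_r; [apply Rlt_le, exp_pos|].
      pose proof (Rmult_le_pos M (x * (1 - x)) (Rabs_pos _) ltac:(nra)). lra.
    (* Case [b > 1]: [w] is concave on [[x0, 1)], so [w'] stays below [M] and [w] is bounded by
       [w x0 + M], while the inverse weight is a positive power of [1 - x^2]. *)
    - exists (- ((1 - b) / 2)), (w x0 + M). split; [lra|]. intros x Hx.
      rewrite Hinv by lra.
      apply Rmult_le_compat_r; [apply Rlt_le, exp_pos|].
      destruct (mean_value_01 w x0 x) as (c & Hc & E); [apply Hw|lra..|].
      destruct (mean_value_01 (Derive w) x0 c) as (d & Hd & E'); [apply Hw|lra..|].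
      rewrite Hode' in E' by lra.
      assert (Hd' : x0 <= d < 1) by lra. specialize (Hquo d Hd').
      assert (0 <= (b - 1) * (b * (w d / (1 - d ^ 2))) * (c - x0))
        by (apply Rmult_le_pos; [apply Rmult_le_pos|]; lra).
      pose proof (Rmult_le_pos (M - Derive w c) (x - x0) ltac:(lra) ltac:(lra)).
      pose proof (Rmult_le_pos M (1 - (x - x0)) (Rabs_pos _) ltac:(lra)).
      lra. }
  destruct Hbound as (e & M' & He & Hbound).
  apply (Rlt_not_le _ _ HC).
  replace 0 with (M' * 0) by ring.
  refine (filterlim_le (F := at_left 1) Omega (fun x => M' * Rpower (1 - x ^ 2) e)
    C (M' * 0) _ Hlim _).
  - now apply at_left_1_intro with x0.
  - apply (filterlim_comp_2 (G := locally M') (H := locally 0)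
      (fun _ => M') (fun x => Rpower (1 - x ^ 2) e) Rmult);
      [apply filterlim_const| |apply (filterlim_mult M' 0)].
    now apply filterlim_Rpower_at_left_1.
Qed.

(** * Sign symmetry and conclusion *)

Lemma weighted_opp (m : R) (f : R -> R) (u : R) :
  weighted m (fun x => - f x) u = - weighted m f u.
Proof. unfold weighted. ring. Qed.

Lemma Derive_weighted_opp (m : R) (f : R -> R) (u : R) :
  Derive (weighted m (fun x => - f x)) u = - Derive (weighted m f) u.
Proof. rewrite (Derive_ext _ _ _ (weighted_opp m f)). apply Derive_opp. Qed.

Theorem mainTheorem1 (nu b : R) (hnu : 0 < nu) (hb : 0 < b) (hb1 : b <> 1) :
  ~ exists (F G Omega : R -> R) (v : vector_field) (p : scalar_field)
           (C_omega : R),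
      C_omega <> 0
      /\ classical_profiles F G Omega
      /\ has_conical_form b F G Omega v
      /\ C1_on half_space_off_axis p
      /\ steady_navier_stokes_on half_space_off_axis nu v p
      /\ ground_conditions F G Omega
      /\ axis_conditions b F Omega C_omega.
Proof.
  intros (F & G & Omega & v & p & C & HC & Hcl & Hv & Hp & HNS & _ & Hlim & _).
  pose proof (swirl_ode nu b F G Omega v p hnu hb1 Hcl Hv Hp HNS) as Hode.
  assert (HO : twice_derivable_on_01 Omega).
  { apply (Ck_twice_derivable_on_01 2); [easy|apply Hcl]. }
  assert (HO' : twice_derivable_on_01 (fun x => - Omega x)).
  { apply twice_derivable_on_01_intro with (fun x => - Derive Omega x).
    intros u Hu. destruct (HO u Hu). split.
    - now apply (is_derive_opp (V := R_NormedModule)), Derive_correct.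
    - now apply (ex_derive_opp (V := R_NormedModule)). }
  (* The swirl equation is linear, so the one-sided bound applies to [Omega] and to its negative,
     giving [C <= 0] and [- C <= 0]. *)
  apply HC, Rle_antisym.
  - eapply swirl_limit_nonpos; [exact hb|exact hb1| |exact Hode|exact Hlim].
    now apply twice_derivable_weighted.
  - apply Ropp_le_cancel. rewrite Ropp_0.
    apply (swirl_limit_nonpos b (- C) (fun x => - Omega x)); try easy.
    + now apply twice_derivable_weighted.
    + intros u Hu.
      rewrite (Derive_ext _ _ _ (Derive_weighted_opp _ Omega)), Derive_opp, weighted_opp.
      generalize (Hode u Hu). lra.
    + eapply filterlim_comp; [exact Hlim|apply (filterlim_opp C)].
Qed.
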